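(* Let $A\in\mathbb{R}^{m\times p}$, $B\in\mathbb{R}^{q\times n}$ and $C\in\mathbb{R}^{m\times n}$ be such that the matrix equation $AXB=C$ is consistent, where $A$ has no zero rows. If $0<\alpha<\frac{2}{\|B\|^2}$, then the sequence $\{X^k\}_{k=0}^\infty$ obtained by the general block Kaczmarz (BK) method $$X^{k+1}=X^k+\frac{\alpha}{\|A_{i_k,:}\|^2}\,A_{i_k,:}^T\,\big(C_{i_k,:}-A_{i_k,:}X^kB\big)B^T,\qquad i_k=(k \bmod m)+1,\quad k=0,1,2,\dots,$$ from an arbitrary initial matrix $X^0\in\mathbb{R}^{p\times q}$ converges to the solution $$X_*^0:=A^+CB^++X^0-A^+A\,X^0\,BB^+ .$$
   Context: The matrix equation $AXB=C$ (unknown $X\in\mathbb{R}^{p\times q}$) is consistent if it has at least one solution. $M_{i,:}$ denotes the $i$th row of a matrix $M$ (a row vector), $A_{i,:}^T$ the transpose of the $i$th row of $A$, $\|\cdot\|$ the 2-norm (spectral norm for matrices), and $M^+$ the Moore--Penrose pseudoinverse of $M$. *)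

(* Defs.v *)
From HB Require Import structures.
From mathcomp Require Import all_boot all_order all_algebra.
From mathcomp Require Import all_classical all_reals all_analysis.

Set Implicit Arguments.
Unset Strict Implicit.
Unset Printing Implicit Defensive.

Import Order.TTheory GRing.Theory Num.Theory.
Import numFieldNormedType.Exports.

Local Open Scope classical_set_scope.
Local Open Scope ring_scope.

(* MathComp-Analysis equips matrices with the max-entry norm `|M|, so the
   Euclidean norm and the operator norm it induces are defined here. *)
Definition norm2 (R : realType) (n : nat) (v : 'cV[R]_n) : R :=
  Num.sqrt (\sum_(i < n) v i 0 ^+ 2).

Definition spectral_norm (R : realType) (m n : nat) (M : 'M[R]_(m, n)) : R :=
  sup [set norm2 (M *m v) | v in [set v : 'cV[R]_n | norm2 v <= 1]].

Definition penrose (R : realType) (m n : nat)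
    (M : 'M[R]_(m, n)) (P : 'M[R]_(n, m)) : Prop :=
  [/\ M *m P *m M = M,
      P *m M *m P = P,
      (M *m P)^T = M *m P
    & (P *m M)^T = P *m M].

(* MathComp's pinvmx is only a generalized inverse: it satisfies the first
   Penrose equation but not the symmetry ones. *)
Definition mp_pinv (R : realType) (m n : nat) (M : 'M[R]_(m, n)) :
    'M[R]_(n, m) := xget 0 [set P | penrose M P].

(* One step of the block Kaczmarz iteration on row i (rows are 0-indexed). *)
Definition BK_step (R : realType) (m p q n : nat) (A : 'M[R]_(m, p))
    (B : 'M[R]_(q, n)) (C : 'M[R]_(m, n)) (alpha : R) (i : 'I_m)
    (X : 'M[R]_(p, q)) : 'M[R]_(p, q) :=
  X + (alpha / norm2 (row i A)^T ^+ 2) *: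
        ((row i A)^T *m (row i C - row i A *m X *m B) *m B^T).

Section Sanity.
Variable R : realType.

Lemma mulmx_tr_eq0 m n (M : 'M[R]_(m, n)) : M *m M^T = 0 -> M = 0.
Proof.
move=> MM0; apply/matrixP => i j; rewrite mxE.
have /eqP := congr1 (fun N : 'M[R]_m => N i i) MM0.
rewrite !mxE psumr_eq0; last by move=> k _; rewrite mxE -expr2 sqr_ge0.
move=> /allP /(_ j (mem_index_enum _)) /=.
by rewrite mxE -expr2 sqrf_eq0 => /eqP.
Qed.

Lemma unitmx_gram m n (M : 'M[R]_(m, n)) : row_free M -> M *m M^T \in unitmx.
Proof.
move=> fM; rewrite -row_free_unit -kermx_eq0; apply/eqP.
set K := kermx _.
have KM : (K *m M) *m (K *m M)^T = 0.
  by rewrite trmx_mul mulmxA -[K *m M *m M^T]mulmxA mulmx_ker mul0mx.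
by apply: (row_free_inj fM); rewrite mul0mx; exact: mulmx_tr_eq0.
Qed.

Lemma penrose_full_rank m r n (F : 'M[R]_(m, r)) (G : 'M[R]_(r, n)) :
  row_free F^T -> row_free G -> exists P, penrose (F *m G) P.
Proof.
move=> fF fG.
have uG := unitmx_gram fG; have := unitmx_gram fF; rewrite trmxK => uF.
set IG := invmx (G *m G^T); set IF := invmx (F^T *m F).
have GK : G *m (G^T *m IG) = 1%:M by rewrite mulmxA mulmxV.
have FK : (IF *m F^T) *m F = 1%:M by rewrite -mulmxA mulVmx.
have sG : IG^T = IG by rewrite /IG trmx_inv trmx_mul trmxK.
have sF : IF^T = IF by rewrite /IF trmx_inv trmx_mul trmxK.
exists (G^T *m IG *m (IF *m F^T)).
have MP : F *m G *m (G^T *m IG *m (IF *m F^T)) = F *m (IF *m F^T).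
  by rewrite mulmxA -[F *m G *m _]mulmxA GK mulmx1.
have PM : G^T *m IG *m (IF *m F^T) *m (F *m G) = G^T *m IG *m G.
  by rewrite -mulmxA [X in _ *m X]mulmxA FK mul1mx.
split.
- by rewrite MP -mulmxA [X in _ *m X]mulmxA FK mul1mx.
- by rewrite PM mulmxA -[X in X *m _]mulmxA GK mulmx1.
- by rewrite MP !trmx_mul trmxK sF mulmxA.
- by rewrite PM !trmx_mul trmxK sG mulmxA.
Qed.

Lemma penrose_exists m n (M : 'M[R]_(m, n)) : exists P, penrose M P.
Proof.
have [|P] := @penrose_full_rank _ _ _ (col_base M) (row_base M) _ (row_base_free M).
  by rewrite /row_free mxrank_tr; exact: col_base_full.
by rewrite mulmx_base; exists P.
Qed.

Lemma mp_pinvP m n (M : 'M[R]_(m, n)) : penrose M (mp_pinv M).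
Proof. exact: xgetPex (penrose_exists M). Qed.

Lemma penrose_uniq m n (M : 'M[R]_(m, n)) P Q :
  penrose M P -> penrose M Q -> P = Q.
Proof.
move=> [P1 P2 P3 P4] [Q1 Q2 Q3 Q4].
have MPQ : M *m P = M *m Q.
  by rewrite -P3 -[in LHS]Q1 -mulmxA trmx_mul P3 Q3 mulmxA P1.
have PQM : P *m M = Q *m M.
  rewrite -P4 -[in LHS]Q1 -[_ *m _ *m M]mulmxA mulmxA trmx_mul P4 Q4.
  by rewrite -mulmxA [M *m (P *m M)]mulmxA P1.
by rewrite -P2 -mulmxA MPQ mulmxA PQM Q2.
Qed.

(* The supremum defining spectral_norm is a genuine one. *)
Lemma spectral_norm_has_sup m n (M : 'M[R]_(m, n)) :
  has_sup [set norm2 (M *m v) | v in [set v : 'cV[R]_n | norm2 v <= 1]].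
Proof.
split.
  exists (norm2 (M *m 0)), 0 => //=; rewrite /norm2 big1 ?sqrtr0 //.
  by move=> i _; rewrite mxE expr0n.
exists (Num.sqrt (\sum_(i < m) (\sum_(j < n) `|M i j|) ^+ 2)) => _ [v /= v1 <-].
rewrite /norm2 ler_wsqrtr //; apply: ler_sum => i _.
rewrite -[leLHS]real_normK ?num_real // ler_pXn2r ?nnegrE ?normr_ge0 ?sumr_ge0 //.
rewrite mxE (le_trans (ler_norm_sum _ _ _)) //; apply: ler_sum => j _.
rewrite normrM ler_piMr // -sqrtr_sqr (le_trans _ v1) // ler_wsqrtr //.
by rewrite (bigD1 j) //= lerDl sumr_ge0 // => k _; rewrite sqr_ge0.
Qed.

End Sanity.

(* Main.v *)
Require Import Defs.
From HB Require Import structures.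
From mathcomp Require Import all_boot all_order all_algebra.
From mathcomp Require Import all_classical all_reals all_analysis.
From mathcomp Require Import ring lra.

Import Order.TTheory GRing.Theory Num.Theory.
Import numFieldNormedType.Exports.

Local Open Scope classical_set_scope.
Local Open Scope ring_scope.

(** Write [E k = X k - Xstar] for the error and [|M|^2] for the squared
    Frobenius norm [frob2 M].  As [Xstar] solves the equation
    ([A A^+ A = A] and [B B^+ B = B] reduce this to consistency), a step using
    the row [r] of [A] changes the error linearly,
      [E' = E - (alpha / |r|^2) r^T (r E B) B^T],
    and, with [w = r E B], expanding the square gives
      [|E'|^2 = |E|^2 - (alpha / |r|^2) (2 |w|^2 - alpha |w B^T|^2)].
    Since [|w B^T| <= ||B|| |w|] and [alpha ||B||^2 < 2], the right-hand side is
    at most [|E|^2] minus a positive multiple of [|w|^2]: a step decreases the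
    error, and the decrease controls both the size of [w] and the length of the
    step ([BK_step_dissipation]).  Being nonincreasing and nonnegative,
    [|E k|^2] converges, so its decrements tend to 0
    ([nonincreasing_gap_cvg0]).  Hence the currently used row of [A (E k) B]
    tends to 0 and so do the increments of [A (E k) B]; as every row is used
    once in any [m] consecutive steps, the whole matrix [A (E k) B] tends to 0
    ([frob2_cyclic_rows_cvg0]).

    It remains to recover [E k] from [A (E k) B].  The term of [Xstar] that
    depends on [X 0] is chosen so that [E 0] has the form [A^+ Z B^+] with
    [Z = A (E 0) B]; equivalently, [E 0] is fixed by the projection
    [M |-> A^+ A M B B^+].  Each correction [r^T w B^T] is fixed by it too
    ([BK_step_row_space]), so [E k = A^+ (A (E k) B) B^+] for all [k], and
    [E k] tends to 0. *)

(** * The squared Frobenius norm *)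

(** The trace form lets inner products be moved around by cyclicity; the sum
    of squares is recovered in [frob2E]. *)
Definition frob2 {R : realType} {m n : nat} (M : 'M[R]_(m, n)) : R :=
  \tr (M *m M^T).

Lemma frob2E {R : realType} {m n : nat} (M : 'M[R]_(m, n)) :
  frob2 M = \sum_i \sum_j M i j ^+ 2.
Proof.
by apply: eq_bigr => i _; rewrite mxE; apply: eq_bigr => j _; rewrite mxE expr2.
Qed.

Lemma frob2_ge0 {R : realType} {m n : nat} (M : 'M[R]_(m, n)) : 0 <= frob2 M.
Proof.
by rewrite frob2E; apply: sumr_ge0 => i _; apply: sumr_ge0 => j _; exact: sqr_ge0.
Qed.

Lemma frob2_eq0 {R : realType} {m n : nat} (M : 'M[R]_(m, n)) :
  frob2 M = 0 -> M = 0.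
Proof.
move=> M0; apply/matrixP => i j; rewrite mxE; apply/eqP.
rewrite -sqrf_eq0 eq_le sqr_ge0 andbT -M0 frob2E (bigD1 i) //= (bigD1 j) //=.
rewrite -addrA lerDl addr_ge0 //; first by apply: sumr_ge0 => k _; exact: sqr_ge0.
by apply: sumr_ge0 => k _; apply: sumr_ge0 => l _; exact: sqr_ge0.
Qed.

Lemma frob2_gt0 {R : realType} {m n : nat} (M : 'M[R]_(m, n)) :
  M != 0 -> 0 < frob2 M.
Proof.
by rewrite lt_def frob2_ge0 andbT; apply: contraNneq => /frob2_eq0 ->.
Qed.

Lemma frob2_tr {R : realType} {m n : nat} (M : 'M[R]_(m, n)) :
  frob2 M^T = frob2 M.
Proof. by rewrite /frob2 trmxK mxtrace_mulC. Qed.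

Lemma frob2Z {R : realType} {m n : nat} (a : R) (M : 'M[R]_(m, n)) :
  frob2 (a *: M) = a ^+ 2 * frob2 M.
Proof. by rewrite /frob2 linearZ /= -scalemxAl -scalemxAr scalerA mxtraceZ. Qed.

Lemma frob20 {R : realType} {m n : nat} : frob2 (0 : 'M[R]_(m, n)) = 0.
Proof. by rewrite /frob2 mul0mx mxtrace0. Qed.

Lemma frob2N {R : realType} {m n : nat} (M : 'M[R]_(m, n)) :
  frob2 (- M) = frob2 M.
Proof. by rewrite -scaleN1r frob2Z sqrrN expr1n mul1r. Qed.

Lemma frob2B {R : realType} {m n : nat} (M N : 'M[R]_(m, n)) :
  frob2 (M - N) = frob2 M - 2 * \tr (M *m N^T) + frob2 N.
Proof.
rewrite /frob2 linearB /= mulmxBl !mulmxBr !linearB /=.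
have -> : \tr (N *m M^T) = \tr (M *m N^T).
  by rewrite -mxtrace_tr trmx_mul trmxK.
ring.
Qed.

Lemma frob2D_le {R : realType} {m n : nat} (M N : 'M[R]_(m, n)) :
  frob2 (M + N) <= 2 * frob2 M + 2 * frob2 N.
Proof.
have := frob2B M N; have := frob2B M (- N); rewrite opprK frob2N.
rewrite linearN mulmxN linearN /=; have := frob2_ge0 (M - N); lra.
Qed.

Lemma frob2_row {R : realType} {m n : nat} (M : 'M[R]_(m, n)) :
  frob2 M = \sum_i frob2 (row i M).
Proof.
rewrite frob2E; apply: eq_bigr => i _; rewrite frob2E big_ord1.
by apply: eq_bigr => j _; rewrite mxE.
Qed.

Lemma frob2_row_le {R : realType} {m n : nat} (M : 'M[R]_(m, n)) i :
  frob2 (row i M) <= frob2 M.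
Proof.
by rewrite [leRHS]frob2_row (bigD1 i) //= lerDl sumr_ge0 // => j _; exact: frob2_ge0.
Qed.

Lemma frob2_col {R : realType} {m n : nat} (M : 'M[R]_(m, n)) :
  frob2 M = \sum_j frob2 (col j M).
Proof.
by rewrite -frob2_tr frob2_row; apply: eq_bigr => j _; rewrite -tr_col frob2_tr.
Qed.

(** The rank-one matrix [r^T v] has Frobenius norm the product of the norms,
    because [r r^T] and [v v^T] are scalars. *)
Lemma frob2_mul_tr_row {R : realType} {p q : nat} (r : 'rV[R]_p) (v : 'rV[R]_q) :
  frob2 (r^T *m v) = frob2 r * frob2 v.
Proof.
have -> : frob2 (r^T *m v) = \tr (r *m r^T *m (v *m v^T)).
  by rewrite /frob2 trmx_mul trmxK [in LHS]mulmxA [LHS]mxtrace_mulC !mulmxA.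
have -> : v *m v^T = (frob2 v)%:M.
  by rewrite /frob2 {1}[v *m v^T]mx11_scalar /mxtrace big_ord1.
by rewrite mul_mx_scalar mxtraceZ mulrC.
Qed.

(** * Comparison with the spectral norm *)

Lemma norm2_sqr {R : realType} {n : nat} (v : 'cV[R]_n) :
  norm2 v ^+ 2 = frob2 v.
Proof.
rewrite sqr_sqrtr; last by apply: sumr_ge0 => i _; exact: sqr_ge0.
by rewrite frob2E; apply: eq_bigr => i _; rewrite big_ord1.
Qed.

Lemma spectral_norm_ge0 {R : realType} {m n : nat} (M : 'M[R]_(m, n)) :
  0 <= spectral_norm M.
Proof.
have [_ ub] := spectral_norm_has_sup M.
apply: (le_trans (y := norm2 (M *m 0))); first exact: sqrtr_ge0.
apply: ub_le_sup => //; exists 0 => //=.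
by rewrite /norm2 big1 ?sqrtr0 // => i _; rewrite mxE expr0n.
Qed.

(** The supremum over the unit ball bounds [|M u|] for the unit vector
    [u = v / |v|], and scaling back by [|v|] gives all [v]. *)
Lemma frob2_mul_col_le {R : realType} {m n : nat} (M : 'M[R]_(m, n))
    (v : 'cV[R]_n) : frob2 (M *m v) <= spectral_norm M ^+ 2 * frob2 v.
Proof.
have [v0|v_neq0] := eqVneq (frob2 v) 0.
  by rewrite v0 (frob2_eq0 _ v0) mulmx0 frob20 mulr0.
have v_gt0 : 0 < frob2 v by rewrite lt_def v_neq0 frob2_ge0.
set c := norm2 v; have c2 : c ^+ 2 = frob2 v := norm2_sqr v.
have c_neq0 : c != 0 by rewrite -sqrf_eq0 c2.
have u1 : frob2 (c^-1 *: v) = 1 by rewrite frob2Z exprVn c2 mulVf.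
have [_ ub] := spectral_norm_has_sup M.
have Mu_le : norm2 (M *m (c^-1 *: v)) <= spectral_norm M.
  apply: ub_le_sup => //; exists (c^-1 *: v) => //=.
  by rewrite -(@ler_pXn2r _ 2) ?nnegrE ?sqrtr_ge0 // norm2_sqr u1 expr1n.
rewrite -[in leLHS](scalerKV c_neq0 v) -scalemxAr frob2Z c2 mulrC ler_pM2r //.
by rewrite -norm2_sqr lerXn2r ?nnegrE ?sqrtr_ge0 ?spectral_norm_ge0.
Qed.

(** Sum the vector bound over the columns of [N].  Besides giving the step-size
    condition, this makes multiplication by a fixed matrix continuous. *)
Lemma frob2_mull_le {R : realType} {m n l : nat} (M : 'M[R]_(m, n))
    (N : 'M[R]_(n, l)) : frob2 (M *m N) <= spectral_norm M ^+ 2 * frob2 N.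
Proof.
rewrite frob2_col [frob2 N]frob2_col mulr_sumr; apply: ler_sum => j _.
by rewrite colE -mulmxA -colE; exact: frob2_mul_col_le.
Qed.

Lemma frob2_mulr_le {R : realType} {m n l : nat} (M : 'M[R]_(m, n))
    (N : 'M[R]_(n, l)) : frob2 (M *m N) <= spectral_norm N^T ^+ 2 * frob2 M.
Proof. by rewrite -frob2_tr trmx_mul -[frob2 M]frob2_tr; exact: frob2_mull_le. Qed.

Lemma frob2_mul2_cvg0 {R : realType} {m n p q : nat} (A : 'M[R]_(m, p))
    (B : 'M[R]_(q, n)) (E : nat -> 'M[R]_(p, q)) :
  frob2 (E k) @[k --> \oo] --> (0 : R) ->
  frob2 (A *m E k *m B) @[k --> \oo] --> (0 : R).
Proof.
move=> E0; set c := spectral_norm B^T ^+ 2 * spectral_norm A ^+ 2.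
apply: (@squeeze_cvgr _ _ _ _ (fun=> 0) (fun k => c * frob2 (E k))).
- near=> k; rewrite frob2_ge0 /=; apply: le_trans (frob2_mulr_le _ _) _.
  by rewrite /c -mulrA ler_wpM2l ?exprn_ge0 ?spectral_norm_ge0 // frob2_mull_le.
- exact: cvg_cst.
- by rewrite -[X in _ --> X](mulr0 c); apply: cvgMr.
Unshelve. all: by end_near. Qed.

(** The topology on matrices is that of the largest entry, whose square is one
    of the terms of [frob2]. *)
Lemma cvg_of_frob2 {R : realType} {m n : nat} (M : nat -> 'M[R]_(m, n))
    (L : 'M[R]_(m, n)) :
  frob2 (M k - L) @[k --> \oo] --> (0 : R) -> M k @[k --> \oo] --> L.
Proof.
move=> ML; apply/cvgrPdist_lt => e e0.
have e20 : 0 < e ^+ 2 by rewrite exprn_gt0.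
move/cvgrPdist_lt/(_ _ e20): ML; apply: filterS => k.
rewrite sub0r normrN ger0_norm ?frob2_ge0 // => lt_e.
rewrite -normrN opprB /Num.norm /= mx_normrE.
apply/bigmax_ltP; split => //= -[i j] _ /=.
rewrite -(@ltr_pXn2r _ 2) ?nnegrE ?normr_ge0 ?ltW // real_normK ?num_real //.
apply: le_lt_trans lt_e; rewrite frob2E (bigD1 i) //= (bigD1 j) //= -addrA lerDl.
rewrite addr_ge0 //; first by apply: sumr_ge0 => l _; exact: sqr_ge0.
by apply: sumr_ge0 => l _; apply: sumr_ge0 => l' _; exact: sqr_ge0.
Qed.

(** * Slowly varying sequences *)

Lemma nonincreasing_gap_cvg0 {R : realType} (u : nat -> R) :
  (forall k, 0 <= u k) -> (forall k, u k.+1 <= u k) ->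
  (u k - u k.+1) @[k --> \oo] --> (0 : R).
Proof.
move=> u_ge0 u_le.
have /cvg_ex[l ul] : cvgn u.
  apply: nonincreasing_is_cvgn; first exact/nonincreasing_seqP.
  by exists 0 => _ [k _ <-].
rewrite -(subrr l); apply: cvgB => //.
by move: ul; rewrite -cvg_shiftS.
Qed.

Lemma frob2_shift_sub_cvg0 {R : realType} {m n : nat} (M : nat -> 'M[R]_(m, n)) :
  frob2 (M k.+1 - M k) @[k --> \oo] --> (0 : R) ->
  forall j, frob2 (M (k + j)%N - M k) @[k --> \oo] --> (0 : R).
Proof.
move=> dM0; elim=> [|j IHj].
  under eq_cvg do rewrite addn0 subrr frob20.
  exact: cvg_cst.
apply: (@squeeze_cvgr _ _ _ _ (fun=> 0) (fun k =>
    2 * frob2 (M (k + j).+1 - M (k + j)%N) + 2 * frob2 (M (k + j)%N - M k))).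
- near=> k; rewrite frob2_ge0 /= addnS.
  by rewrite -[M _ - M k](subrKA (M (k + j)%N)) frob2D_le.
- exact: cvg_cst.
- rewrite -[X in _ --> X](addr0 (0 : R)) -[X in _ --> X + X](mulr0 2).
  apply: cvgD; apply: cvgMr => //.
  by move: dM0; rewrite -(cvg_shiftn j).
Unshelve. all: by end_near. Qed.

Lemma cvg_sum_ord {R : realType} {m : nat} (F : 'I_m -> nat -> R)
    (l : 'I_m -> R) :
  (forall i, F i k @[k --> \oo] --> l i) ->
  (\sum_i F i k) @[k --> \oo] --> \sum_i l i.
Proof.
move=> Fl; apply: (@cvg_big R 'I_m +%R 0 xpredT _ nat \oo _ F l) => //.
exact: add_continuous.
Qed.

(** The row [i] of [M k] is compared with the row [i] of [M (k + j)], where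
    [j < m] is the delay until the index [i] comes up in the cycle.  The delay
    varies with [k] but takes only [m] values, so the sum over all delays is a
    null sequence dominating every row. *)
Lemma frob2_cyclic_rows_cvg0 {R : realType} {m n : nat} (m_gt0 : (0 < m)%N)
    (M : nat -> 'M[R]_(m, n)) :
  frob2 (row (Ordinal (ltn_pmod k m_gt0)) (M k)) @[k --> \oo] --> (0 : R) ->
  frob2 (M k.+1 - M k) @[k --> \oo] --> (0 : R) ->
  frob2 (M k) @[k --> \oo] --> (0 : R).
Proof.
set idx := fun k => Ordinal (ltn_pmod k m_gt0) => row0 dM0.
pose h k (j : 'I_m) : R := 2 * frob2 (row (idx (k + j)%N) (M (k + j)%N))
  + 2 * frob2 (M (k + j)%N - M k).
have h_ge0 k j : 0 <= h k j by rewrite addr_ge0 // mulr_ge0 ?frob2_ge0.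
have row_le k i : frob2 (row i (M k)) <= \sum_j h k j.
  (* [j] is the residue of [i - k] modulo [m]. *)
  pose j := idx (i + (m - k %% m))%N.
  have ij : i = idx (k + j)%N.
    have km : (k %% m <= m)%N by rewrite ltnW // ltn_pmod.
    apply: val_inj; rewrite /= modnDmr -modnDml addnCA subnKC //.
    by rewrite modnDr modn_small.
  apply: (le_trans (y := h k j)); last first.
    by rewrite (bigD1 j) //= lerDl sumr_ge0.
  rewrite /h -ij -[in leLHS](subKr (M (k + j)%N) (M k)) linearB /=.
  apply: le_trans (frob2D_le _ _) _; rewrite frob2N lerD2l ler_wpM2l //.
  exact: frob2_row_le.
have h0 : (\sum_(i < m) \sum_j h k j) @[k --> \oo] --> (0 : R).
  have sum0 : \sum_(i < m) 0 = 0 :> R by rewrite big1.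
  rewrite -[X in _ --> X]sum0.
  apply: (cvg_sum_ord (fun _ k => \sum_j h k j) (fun=> 0)) => _.
  rewrite -[X in _ --> X]sum0.
  apply: (cvg_sum_ord (fun j k => h k j) (fun=> 0)) => j; rewrite /h.
  rewrite -[X in _ --> X](addr0 (0 : R)) -[X in _ --> X + X](mulr0 2).
  apply: cvgD; apply: cvgMr; last exact: frob2_shift_sub_cvg0.
  by move: row0; rewrite -(cvg_shiftn j).
apply: squeeze_cvgr (cvg_cst 0) h0; near=> k.
by rewrite frob2_ge0 /= frob2_row; apply: ler_sum => i _; exact: row_le.
Unshelve. all: by end_near. Qed.

(** * One step of the iteration *)

(** The cross term of the square is the inner product of [E] with
    [r^T w B^T], which equals that of [r E B] with [w], that is [|w|^2]. *)
Lemma frob2_BK_error {R : realType} {p q n : nat} (r : 'rV[R]_p)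
    (B : 'M[R]_(q, n)) (alpha : R) (E : 'M[R]_(p, q)) :
  r != 0 ->
  let w := r *m E *m B in
  frob2 (E - (alpha / frob2 r) *: (r^T *m w *m B^T)) =
  frob2 E - alpha / frob2 r * (2 * frob2 w - alpha * frob2 (w *m B^T)).
Proof.
move=> r_neq0 w.
have rho_neq0 : frob2 r != 0 by rewrite gt_eqF ?frob2_gt0.
have cross : \tr (E *m (r^T *m w *m B^T)^T) = frob2 w.
  rewrite 2!trmx_mul !trmxK mulmxA mulmxA mxtrace_mulC mulmxA mulmxA.
  by rewrite -/w.
rewrite frob2B [(_ *: _)^T]linearZ -[X in \tr X]scalemxAr mxtraceZ cross frob2Z.
by rewrite -mulmxA frob2_mul_tr_row; field.
Qed.

Lemma BK_step_error {R : realType} {m p q n : nat} (A : 'M[R]_(m, p))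
    (B : 'M[R]_(q, n)) (C : 'M[R]_(m, n)) (alpha : R) (i : 'I_m)
    (X S : 'M[R]_(p, q)) :
  A *m S *m B = C ->
  let r := row i A in
  BK_step A B C alpha i X - S =
  (X - S) - (alpha / frob2 r) *: (r^T *m (r *m (X - S) *m B) *m B^T).
Proof.
move=> SC r; rewrite /BK_step norm2_sqr frob2_tr -/r -SC !row_mul -/r.
rewrite -mulmxBl -mulmxBr -[S - X]opprB !(mulmxN, mulNmx) scalerN.
by rewrite addrAC mulmxA.
Qed.

(** All three bounds follow from
    [(alpha / |r|^2) d |w|^2 <= |E|^2 - |E'|^2]; bounding [|r|^2] by [|A|^2]
    makes the constants the same for all rows. *)
Lemma BK_step_dissipation {R : realType} {m p q n : nat} (A : 'M[R]_(m, p))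
    (B : 'M[R]_(q, n)) (alpha : R) (i : 'I_m) (E : 'M[R]_(p, q)) :
  0 < alpha -> alpha * spectral_norm B ^+ 2 < 2 -> row i A != 0 ->
  let r := row i A in
  let w := r *m E *m B in
  let E' := E - (alpha / frob2 r) *: (r^T *m w *m B^T) in
  let d := 2 - alpha * spectral_norm B ^+ 2 in
  [/\ frob2 E' <= frob2 E,
      frob2 w <= frob2 A / (alpha * d) * (frob2 E - frob2 E') &
      frob2 (E' - E) <= alpha * spectral_norm B ^+ 2 / d * (frob2 E - frob2 E')].
Proof.
move=> a_gt0 ad r_neq0 r w E' d.
have d_gt0 : 0 < d by rewrite subr_gt0.
have rho_gt0 : 0 < frob2 r := frob2_gt0 _ r_neq0.
have wB : frob2 (w *m B^T) <= spectral_norm B ^+ 2 * frob2 w.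
  by have := frob2_mulr_le w B^T; rewrite trmxK.
have gap : alpha / frob2 r * (d * frob2 w) <= frob2 E - frob2 E'.
  rewrite [frob2 E']frob2_BK_error // subKr ler_wpM2l //.
    by rewrite ltW // divr_gt0.
  have : alpha * frob2 (w *m B^T) <= alpha * (spectral_norm B ^+ 2 * frob2 w).
    by rewrite ler_wpM2l // ltW.
  by rewrite /d -/w; lra.
have w_le : alpha * d * frob2 w <= frob2 r * (frob2 E - frob2 E').
  have -> : alpha * d * frob2 w = frob2 r * (alpha / frob2 r * (d * frob2 w)).
    by field; rewrite gt_eqF.
  by rewrite ler_wpM2l // ltW.
have gap_ge0 : 0 <= frob2 E - frob2 E'.
  by apply: le_trans gap; rewrite !mulr_ge0 ?invr_ge0 ?frob2_ge0 // ltW.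
split; first by rewrite -subr_ge0.
- rewrite mulrAC ler_pdivlMr ?mulr_gt0 // mulrC (le_trans w_le) //.
  by rewrite ler_wpM2r // frob2_row_le.
- have -> : frob2 (E' - E) = alpha ^+ 2 / frob2 r * frob2 (w *m B^T).
    rewrite /E' addrAC subrr sub0r frob2N frob2Z -mulmxA frob2_mul_tr_row.
    by field; rewrite gt_eqF.
  apply: (le_trans (y := alpha ^+ 2 / frob2 r * (spectral_norm B ^+ 2 * frob2 w))).
    by rewrite ler_wpM2l // divr_ge0 ?exprn_ge0 ?ltW.
  have -> : alpha ^+ 2 / frob2 r * (spectral_norm B ^+ 2 * frob2 w) =
     alpha * spectral_norm B ^+ 2 / d * (alpha / frob2 r * (d * frob2 w)).
    by field; rewrite !gt_eqF.
  by rewrite ler_wpM2l // divr_ge0 ?mulr_ge0 ?exprn_ge0 ?spectral_norm_ge0 ?ltW.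
Qed.

(** [A^+ A] is the orthogonal projector onto the span of the rows of [A], so it
    fixes [r^T]; likewise [B B^+] is the orthogonal projector onto the column
    space of [B], so [B^T] absorbs it on the right.  The symmetry Penrose
    equations are what makes these two facts hold. *)
Lemma BK_step_row_space {R : realType} {m p q n : nat} (A : 'M[R]_(m, p))
    (B : 'M[R]_(q, n)) A' B' (i : 'I_m) (E : 'M[R]_(p, q)) (c : R) (v : 'rV[R]_n) :
  penrose A A' -> penrose B B' ->
  E = A' *m (A *m E *m B) *m B' ->
  let E' := E - c *: ((row i A)^T *m v *m B^T) in
  E' = A' *m (A *m E' *m B) *m B'.
Proof.
move=> [A1 _ _ A4] [B1 _ B3 _] E_proj E'.
have rowA : A' *m A *m (row i A)^T = (row i A)^T.
  by rewrite -A4 -trmx_mul -row_mul mulmxA A1.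
have BBB : B^T *m (B *m B') = B^T by rewrite -B3 -trmx_mul B1.
rewrite /E' !(mulmxBr, mulmxBl) -E_proj -!scalemxAr -!scalemxAl.
by rewrite -!scalemxAr -!scalemxAl !mulmxA rowA -(mulmxA _ B) -(mulmxA _ B^T) BBB.
Qed.

(** * Convergence *)

Theorem theorem3p2 (R : realType) (m p q n : nat) (m_gt0 : (0 < m)%N)
    (A : 'M[R]_(m, p)) (B : 'M[R]_(q, n)) (C : 'M[R]_(m, n))
    (consistent : exists Y : 'M[R]_(p, q), A *m Y *m B = C)
    (A_rows : forall i : 'I_m, row i A != 0)
    (alpha : R) (alpha_gt0 : 0 < alpha)
    (alpha_lt : alpha < 2 / spectral_norm B ^+ 2)
    (X : nat -> 'M[R]_(p, q))
    (X_BK : forall k : nat,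
       X k.+1 = BK_step A B C alpha (Ordinal (ltn_pmod k m_gt0)) (X k)) :
  let Xstar := mp_pinv A *m C *m mp_pinv B + X 0%N
               - mp_pinv A *m A *m X 0%N *m B *m mp_pinv B in
  A *m Xstar *m B = C /\ X k @[k --> \oo] --> Xstar.
Proof.
move=> Xstar; have [Y YC] := consistent.
have [A1 _ _ _] := mp_pinvP A; have [B1 _ _ _] := mp_pinvP B.
set A' := mp_pinv A in Xstar A1 *; set B' := mp_pinv B in Xstar B1 *.
have XstarC : A *m Xstar *m B = C.
  rewrite /Xstar mulmxBr mulmxDr mulmxBl mulmxDl -YC !mulmxA A1.
  by rewrite -!(mulmxA _ B B') -!(mulmxA _ (B *m B') B) B1 -!mulmxA addrK.
split=> //; apply: cvg_of_frob2.
pose E k := X k - Xstar.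
pose idx k := Ordinal (ltn_pmod k m_gt0).
have ES k : E k.+1 = E k - (alpha / frob2 (row (idx k) A)) *:
    ((row (idx k) A)^T *m (row (idx k) A *m E k *m B) *m B^T).
  by rewrite /E X_BK BK_step_error.
have proj_E k : E k = A' *m (A *m E k *m B) *m B'.
  elim: k => [|k IHk].
    have -> : E 0%N = A' *m (A *m (X 0%N - Y) *m B) *m B'.
      rewrite /E /Xstar -YC; rewrite !(mulmxBr, mulmxBl) !mulmxA.
      by rewrite [_ + X 0%N - _]addrAC opprD [LHS]addrC addrNK opprB.
    congr (_ *m _ *m _); rewrite !mulmxA A1.
    by rewrite -(mulmxA _ B B') -(mulmxA _ (B *m B') B) B1.
  by rewrite ES; apply: BK_step_row_space => //; exact: mp_pinvP.
(* If [B] had spectral norm 0, the bound on [alpha] would read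
   [alpha < 2 / 0 = 0]. *)
have s_gt0 : 0 < spectral_norm B ^+ 2.
  rewrite lt_def exprn_ge0 ?spectral_norm_ge0 // andbT.
  by apply/eqP => s0; move: alpha_lt; rewrite s0 invr0 mulr0 ltNge ltW.
have ad : alpha * spectral_norm B ^+ 2 < 2 by rewrite -ltr_pdivlMr.
have diss k := BK_step_dissipation A B alpha (idx k) (E k) alpha_gt0 ad (A_rows _).
have gap0 : (frob2 (E k) - frob2 (E k.+1)) @[k --> \oo] --> (0 : R).
  apply: (nonincreasing_gap_cvg0 (fun k => frob2 (E k))) => k.
    exact: frob2_ge0.
  by have [le_E _ _] := diss k; rewrite ES.
have gap_dom (u : nat -> R) (c : R) : (forall k, 0 <= u k) ->
    (forall k, u k <= c * (frob2 (E k) - frob2 (E k.+1))) ->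
    u k @[k --> \oo] --> (0 : R).
  move=> u_ge0 u_le.
  have c0 : c * (frob2 (E k) - frob2 (E k.+1)) @[k --> \oo] --> (0 : R).
    by rewrite -[X in _ --> X](mulr0 c); apply: cvgMr.
  by apply: squeeze_cvgr (cvg_cst 0) c0; near=> k; rewrite u_ge0 u_le.
under eq_cvg do rewrite -/(E _) proj_E.
apply: frob2_mul2_cvg0; apply: (frob2_cyclic_rows_cvg0 m_gt0).
- apply: gap_dom => k; first exact: frob2_ge0.
  by have [_ w_le _] := diss k; rewrite ES !row_mul; exact: w_le.
- under eq_cvg do rewrite -mulmxBl -mulmxBr.
  apply: frob2_mul2_cvg0; apply: gap_dom => k; first exact: frob2_ge0.
  by have [_ _ dE_le] := diss k; rewrite ES; exact: dE_le.
Unshelve. all: by end_near. Qed.
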